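(* Let $\mathcal{A}$ be a locally finite hyperplane arrangement in $\mathbb{R}^n$, and let $\dashv_{eu}$ be a Euclidean order on $\mathcal{C}(\mathcal{A})$ with base point $x_0$. For every chamber $C$, let $x_C = \rho_C(x_0)$ and let $F_C$ be the smallest face of $C$ that contains $x_C$. Then $\mathcal{J}(C)$ is the principal upper ideal of $\mathcal{L}(\mathcal{A})$ generated by $X_C = |F_C|$. Therefore $\dashv_{eu}$ is a valid order.
   Context: $\mathcal{A}$ is a locally finite set of affine hyperplanes in $\mathbb{R}^n$. Faces are the closures of the strata of the induced stratification of $\mathbb{R}^n$ (two points are in the same stratum iff, for each $H\in\mathcal{A}$, both lie on $H$ or both lie strictly on the same side of $H$); chambers are faces of codimension $0$, and $\mathcal{C}=\mathcal{C}(\mathcal{A})$ is the set of chambers. For chambers $C,C'$, $s(C,C')\subseteq\mathcal{A}$ is the set of hyperplanes separating them. $\mathcal{L}=\mathcal{L}(\mathcal{A})$ is the poset of flats ((nonempty) intersections of hyperplanes of $\mathcal{A}$, including $\mathbb{R}^n$), ordered by reverse inclusion. For $U\subseteq\mathbb{R}^n$, $\mathrm{supp}(U)=\{H\in\mathcal{A}\mid U\subseteq H\}$ and $|U|$ is the affine span of $U$. $d$ is the Euclidean distance, and $\rho_K(x)$ is the projection of $x$ onto a closed convex set $K$ (the unique $y\in K$ with $d(x,y)=d(x,K)$). A point $x\in\mathbb{R}^n$ is generic (with respect to $\mathcal{A}$) if: (i) for all $C,C'\in\mathcal{C}$ with $d(x,C)=d(x,C')$ we have $\rho_C(x)=\rho_{C'}(x)\in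 C\cap C'$; (ii) for all $L,L'\in\mathcal{L}$ with $L'\subsetneq L$ we have $d(x,L')>d(x,L)$. A total order $\dashv_{eu}$ on $\mathcal{C}$ is Euclidean with base point $x_0$ if $x_0$ is generic and $C\dashv_{eu}C'$ implies $d(x_0,C)\leq d(x_0,C')$. Given a total order $\dashv$ on $\mathcal{C}$, let $\mathcal{J}(C)=\{X\in\mathcal{L}\mid \mathrm{supp}(X)\cap s(C,C')\neq\emptyset\text{ for all }C'\dashv C\}$. The order $\dashv$ is valid if, for every chamber $C$, $\mathcal{J}(C)$ is a principal upper ideal of $\mathcal{L}$ generated by some flat of the form $|F|$ with $F$ a face of $C$. *)

(* Defs.v *)
From HB Require Import structures.
From mathcomp Require Import all_boot all_order all_algebra.
From mathcomp Require Import all_classical all_reals all_analysis.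
Set Implicit Arguments.
Unset Strict Implicit.
Unset Printing Implicit Defensive.
Import Order.TTheory GRing.Theory Num.Theory.
Import numFieldNormedType.Exports.
Local Open Scope classical_set_scope.
Local Open Scope ring_scope.

(* R^n is 'rV[R]_n. Only its topology is taken from the library: the norm the
   library puts on matrices is the sup norm, so the Euclidean distance is
   defined here. *)

Section Euclidean.
Context {R : realType} {n : nat}.
Implicit Types (x y a : 'rV[R]_n) (b : R) (U K H : set 'rV[R]_n).

Definition dot a x : R := \sum_(i < n) a 0 i * x 0 i.

Definition eucl_dist x y : R := Num.sqrt (\sum_(i < n) (x 0 i - y 0 i) ^+ 2).

Definition dist_to x K : R := inf [set eucl_dist x y | y in K].

(* The projection of x onto K; the default value 0 is irrelevant for K nonempty, closed and
   convex, as the nearest point then exists and is unique. *)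
Definition rho K x : 'rV[R]_n :=
  xget 0 [set y | K y /\ eucl_dist x y = dist_to x K].

Definition affine_span U : set 'rV[R]_n :=
  [set x | exists (m : nat) (l : 'I_m -> R) (p : 'I_m -> 'rV[R]_n),
     [/\ forall i, U (p i), \sum_(i < m) l i = 1 &
         x = \sum_(i < m) l i *: p i]].

Definition has_codim U (k : nat) : Prop :=
  exists (p : 'rV[R]_n) (V : {vspace 'rV[R]_n}),
    affine_span U = [set x | x - p \in V] /\ (\dim V + k)%N = n.

Definition hyperplane a b : set 'rV[R]_n := [set x | dot a x = b].

Definition is_hyperplane H : Prop :=
  exists a b, a != 0 /\ H = hyperplane a b.

(* The equation (a, b) of H is only determined up to a nonzero scalar;
   replacing it by (- a, - b) exchanges the two sides of H. *)
Definition strictly_same_side H x y : Prop :=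
  exists a b, [/\ a != 0, H = hyperplane a b, b < dot a x & b < dot a y].

(* Stated for closed sets such as chambers, which may meet H. *)
Definition separates H U K : Prop :=
  exists a b, [/\ a != 0, H = hyperplane a b,
    U `<=` [set x | dot a x <= b] & K `<=` [set x | b <= dot a x]].

End Euclidean.

Section Arrangement.
Context {R : realType} {n : nat}.
Implicit Types (A : set (set 'rV[R]_n)) (x y : 'rV[R]_n).
Implicit Types (C F U X Y L : set 'rV[R]_n).

Definition locally_finite A : Prop :=
  forall x, exists2 U, nbhs x U &
    finite_set [set H | A H /\ H `&` U !=set0].

Definition is_arrangement A : Prop :=
  (forall H, A H -> is_hyperplane H) /\ locally_finite A.

Definition same_stratum A x y : Prop :=
  forall H, A H -> (H x /\ H y) \/ strictly_same_side H x y.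

Definition face A F : Prop :=
  exists x, F = closure [set y | same_stratum A x y].

Definition chamber A C : Prop := face A C /\ has_codim C 0.

Definition face_of A C F : Prop := face A F /\ F `<=` C.

Definition is_smallest_face A C x F : Prop :=
  [/\ face_of A C F, F x & forall G, face_of A C G -> G x -> F `<=` G].

Definition sep A C C' : set (set 'rV[R]_n) :=
  [set H | A H /\ separates H C C'].

(* B = set0 gives R^n. *)
Definition flat A X : Prop :=
  X !=set0 /\ exists2 B, B `<=` A & X = \bigcap_(H in B) H.

Definition flat_le X Y : Prop := Y `<=` X.

Definition supp A U : set (set 'rV[R]_n) := [set H | A H /\ U `<=` H].

Definition generic A x : Prop :=
  (forall C C', chamber A C -> chamber A C' ->
     dist_to x C = dist_to x C' ->
     rho C x = rho C' x /\ (C `&` C') (rho C x)) /\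
  (forall L L', flat A L -> flat A L' -> L' `<` L ->
     dist_to x L < dist_to x L').

(* Orders on the set of chambers are strict (C' -| C implies C' <> C), as
   required by the definition of J below; only the values of ord on chambers
   matter. *)
Implicit Type ord : set 'rV[R]_n -> set 'rV[R]_n -> Prop.

Definition total_order_on_chambers A ord : Prop :=
  [/\ forall C, chamber A C -> ~ ord C C,
      forall C1 C2 C3, chamber A C1 -> chamber A C2 -> chamber A C3 ->
        ord C1 C2 -> ord C2 C3 -> ord C1 C3 &
      forall C C', chamber A C -> chamber A C' ->
        [\/ ord C C', C = C' | ord C' C]].

Definition euclidean_order A ord x0 : Prop :=
  [/\ total_order_on_chambers A ord, generic A x0 &
      forall C C', chamber A C -> chamber A C' -> ord C C' ->
        dist_to x0 C <= dist_to x0 C'].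

Definition J A ord C : set (set 'rV[R]_n) :=
  [set X | flat A X /\
     forall C', chamber A C' -> ord C' C -> supp A X `&` sep A C C' !=set0].

Definition principal_upper_ideal A (I : set (set 'rV[R]_n)) X : Prop :=
  flat A X /\ I = [set Y | flat A Y /\ flat_le X Y].

Definition valid_order A ord : Prop :=
  total_order_on_chambers A ord /\
  forall C, chamber A C ->
    exists2 F, face_of A C F &
      principal_upper_ideal A (J A ord C) (affine_span F).

End Arrangement.

(* Main.v *)
(* Faces are described by signs: if [z] is a point of a chamber C, the hyperplanes
   missing [z] do not matter near [z], so C coincides near [z] with the cone K_z
   cut out by the hyperplanes through [z], the smallest face of C containing [z]
   is the closure of the stratum of [z], and its affine span is the intersection
   of the hyperplanes through [z].  Take z = x_C.

   If C' precedes C and no hyperplane through x_C separates C and C', then C' lies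
   in the cone K_(x_C), whose nearest point to x_0 is x_C by convexity; hence
   x_C' = x_C, and every hyperplane separating C and C' contains this common point,
   so there is none: a contradiction.

   Conversely, let Y be in J(C), and let K be the intersection of the half-spaces
   containing C bounded by the hyperplanes that contain Y.  Every point of K lies
   in a chamber not separated from C by a hyperplane containing Y, so no point of K
   is closer to x_0 than x_C.  By convexity x_C is then also nearest to x_0 in the
   intersection Z of the hyperplanes containing both Y and x_C.  Since X_C is
   contained in Z and contains x_C, genericity forces X_C = Z, which contains Y. *)
Require Import Defs.
From mathcomp Require Import all_boot all_order all_algebra.
From mathcomp Require Import all_classical all_reals all_analysis.
From mathcomp Require Import ring lra.
Set Implicit Arguments.
Unset Strict Implicit.
Unset Printing Implicit Defensive.
Import Order.TTheory GRing.Theory Num.Theory.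
Import numFieldNormedType.Exports.
Local Open Scope classical_set_scope.
Local Open Scope ring_scope.

(** * Scalar product, Euclidean distance and nearest points *)

Section EuclideanGeometry.
Context {R : realType} {n : nat}.
Implicit Types (a x y z u v w : 'rV[R]_n) (b t e : R) (H K : set 'rV[R]_n).

Lemma dotDZ a x w t : dot a (x + t *: w) = dot a x + t * dot a w.
Proof.
rewrite /dot mulr_sumr -big_split /=; apply: eq_bigr => i _.
by rewrite !mxE; ring.
Qed.

Lemma dot_lincomb a m (l : 'I_m -> R) (p : 'I_m -> 'rV[R]_n) :
  dot a (\sum_(i < m) l i *: p i) = \sum_(i < m) l i * dot a (p i).
Proof.
elim/big_rec2: _ => [|i s v _ <-]; last by rewrite addrC dotDZ addrC.
by rewrite /dot big1 // => i _; rewrite mxE mulr0.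
Qed.

Lemma dotC x y : dot x y = dot y x.
Proof. by apply: eq_bigr => i _; rewrite mulrC. Qed.

Lemma dotNl a x : dot (- a) x = - dot a x.
Proof. by rewrite /dot -sumrN; apply: eq_bigr => i _; rewrite mxE mulNr. Qed.

Lemma dot_ge0 x : 0 <= dot x x.
Proof. by apply: sumr_ge0 => i _; rewrite -expr2 sqr_ge0. Qed.

Lemma dot_eq0 x : dot x x = 0 -> x = 0.
Proof.
move=> /psumr_eq0P x0; apply/rowP => i; rewrite mxE; apply/eqP.
by rewrite -sqrf_eq0 expr2 x0 // => j _; rewrite -expr2 sqr_ge0.
Qed.

Lemma dot_continuous a : continuous (dot a).
Proof.
apply: continuous_big => [|i _ x]; first exact: add_continuous.
by apply: (continuousM (@cst_continuous _ _ (a 0 i) _)); exact: coord_continuous.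
Qed.

Lemma eucl_distE x y : eucl_dist x y = Num.sqrt (dot (x - y) (x - y)).
Proof. by congr Num.sqrt; apply: eq_bigr => i _; rewrite !mxE expr2. Qed.

Lemma eucl_dist_continuous x : continuous (eucl_dist x).
Proof.
move=> y; apply: continuous_comp; last exact: sqrt_continuous.
apply: continuous_big y => [|i _ y]; first exact: add_continuous.
have cB : {for y, continuous (fun z : 'rV[R]_n => x 0 i - z 0 i)}.
  by apply: (continuousB (@cst_continuous _ _ (x 0 i) _)); exact: coord_continuous.
exact: (continuousM cB cB).
Qed.

Lemma norm_coord_le_dist x y i : `|x 0 i - y 0 i| <= eucl_dist x y.
Proof.
rewrite -sqrtr_sqr ler_wsqrtr // (bigD1 i) //= lerDl.
by apply: sumr_ge0 => j _; rewrite sqr_ge0.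
Qed.

Lemma nbhs_segment {x} {U : set 'rV[R]_n} w : nbhs x U ->
  exists2 e, 0 < e & forall t, 0 <= t <= e -> U (x + t *: w).
Proof.
move=> xU.
have line_cont : continuous (fun t : R => x + t *: w).
  by move=> t; apply: cvgD; [exact: cvg_cst|apply: cvgZr_tmp; exact: cvg_id].
have := line_cont 0; rewrite /continuous_at scale0r addr0.
move=> /(_ _ xU) /nbhs_ballP[e /= e0 eU]; exists (e / 2); first by rewrite divr_gt0.
move=> t /andP[t0 te]; apply: eU; rewrite /ball /= sub0r normrN ger0_norm //; lra.
Qed.

Lemma dist_to_le x K y : K y -> dist_to x K <= eucl_dist x y.
Proof.
by move=> Ky; apply: ge_inf; [exists 0 => _ [z _ <-]; exact: sqrtr_ge0|exists y].
Qed.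

Lemma dist_to_ge x K b : K !=set0 -> (forall y, K y -> b <= eucl_dist x y) ->
  b <= dist_to x K.
Proof.
move=> [y Ky] Kb; apply: lb_le_inf; first by exists (eucl_dist x y), y.
by move=> _ [z Kz <-]; exact: Kb.
Qed.

(** A minimizer exists by compactness: the points of [K] no farther from [x] than [y0] lie in a cube
    centred at [x], each coordinate difference being bounded by the distance. *)
Lemma rho_nearest K x : closed K -> K !=set0 ->
  K (rho K x) /\ eucl_dist x (rho K x) = dist_to x K.
Proof.
move=> Kcl [y0 Ky0]; pose B := [set y | eucl_dist x y <= eucl_dist x y0].
have Bcl : closed B.
  have -> : B = eucl_dist x @^-1` [set r | r <= eucl_dist x y0] by [].
  by apply: preimage_closed; [move=> y _; exact: eucl_dist_continuous|exact: closed_le].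
have KBcpt : compact (K `&` B).
  pose r := eucl_dist x y0.
  have cube_cpt := @rV_compact _ n (fun i => `[x 0 i - r, x 0 i + r]%classic)
    (fun=> @segment_compact _ _ _).
  apply: subclosed_compact cube_cpt _; first exact: closedI.
  move=> y [_ By] i /=; rewrite in_itv /= -ler_distlC.
  exact: le_trans (norm_coord_le_dist _ _ _) By.
have KB0 : K `&` B !=set0 by exists y0; split=> //; exact: lexx.
have [c] := compact_EVT_min KB0 KBcpt (continuous_subspaceT (@eucl_dist_continuous x)).
rewrite inE => -[Kc Bc] cmin.
apply: (@xgetPex _ 0 [set y | K y /\ eucl_dist x y = dist_to x K]).
exists c; split=> //; apply/eqP; rewrite eq_le dist_to_le // andbT.
apply: dist_to_ge => [|y Ky]; first by exists y0.
have [By|/ltW] := leP (eucl_dist x y) (eucl_dist x y0); last exact: le_trans.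
by apply: cmin; rewrite inE.
Qed.

(** Along the ray the squared distance is |x - u|^2 - 2tp + t^2 q. Minimality near t = 0 forces p <=
    0, so the value at t = 1 exceeds the one at 0 by at least q = |v - u|^2. *)
Lemma nearest_on_ray x u v e : 0 < e ->
  (forall t, 0 <= t <= e -> eucl_dist x u <= eucl_dist x (u + t *: (v - u))) ->
  eucl_dist x u <= eucl_dist x v /\ (eucl_dist x v <= eucl_dist x u -> u = v).
Proof.
move=> e0 min_u; set p := dot (x - u) (v - u); set q := dot (v - u) (v - u).
have q0 : 0 <= q := dot_ge0 _.
have distE t : dot (x - (u + t *: (v - u))) (x - (u + t *: (v - u))) =
    dot (x - u) (x - u) - 2 * t * p + t ^+ 2 * q.
  have -> : x - (u + t *: (v - u)) = (x - u) + (- t) *: (v - u).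
    by rewrite scaleNr opprD addrA.
  by rewrite dotDZ ![dot (_ + _ *: _) _]dotC !dotDZ -/q (dotC (v - u)) -/p; ring.
have p0 : p <= 0.
  rewrite leNgt; apply/negP => p_gt0.
  (* If p > 0, this t has t q < p, so the quadratic drops below its value at 0; the [+ 1] keeps the
     divisor positive when q = 0. *)
  pose t := Num.min e (p / (q + 1)).
  have q1 : 0 < q + 1 by lra.
  have t0 : 0 < t by rewrite lt_min e0 divr_gt0.
  have te : t <= e by rewrite ge_min lexx.
  have tp : t * (q + 1) <= p by rewrite -ler_pdivlMr // ge_min lexx orbT.
  have := min_u t; rewrite (ltW t0) te => /(_ isT).
  rewrite !eucl_distE ler_sqrt ?dot_ge0 // distE => ineq.
  have : t * (2 * p - t * q) <= 0 by nra.
  rewrite pmulr_rle0 //; nra.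
have := distE 1; rewrite scale1r (addrC u) subrK => vE.
rewrite !eucl_distE !ler_sqrt ?dot_ge0 // vE; split=> [|le_vu]; first by lra.
have /dot_eq0 : q = 0 by lra.
by move/eqP; rewrite subr_eq0 => /eqP.
Qed.

End EuclideanGeometry.

(** * Equations of hyperplanes and the sides they define *)

Section Height.
Context {R : realType} {n : nat}.
Implicit Types (a x y z u v w : 'rV[R]_n) (b t e : R) (H U K : set 'rV[R]_n).

(* Equations are unique only up to a nonzero scalar: of [height H] below, only the
   zeros and the sign of a product of two values are intrinsic. *)
Definition equation H : 'rV[R]_n * R :=
  xget (0, 0) [set ab | ab.1 != 0 /\ H = hyperplane ab.1 ab.2].

Definition height H x : R := dot (equation H).1 x - (equation H).2.

Lemma equationP H : is_hyperplane H ->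
  (equation H).1 != 0 /\ H = hyperplane (equation H).1 (equation H).2.
Proof.
move=> [a [b ab]].
apply: (@xgetPex _ (0, 0) [set ab | ab.1 != 0 /\ H = hyperplane ab.1 ab.2]).
by exists (a, b).
Qed.

Lemma height_eq0 H x : is_hyperplane H -> H x <-> height H x = 0.
Proof.
move=> /equationP[_ {1}->]; rewrite /height /hyperplane /=.
by split=> [->|/eqP]; rewrite ?subrr // subr_eq0 => /eqP.
Qed.

Lemma heightDZ H x w t : height H (x + t *: w) = height H x + t * dot (equation H).1 w.
Proof. by rewrite /height dotDZ; ring. Qed.

Lemma height_segment H x y t :
  height H (x + t *: (y - x)) = (1 - t) * height H x + t * height H y.
Proof. by rewrite /height -scaleN1r addrC !dotDZ; ring. Qed.

Lemma height_continuous H : continuous (height H).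
Proof.
move=> x; apply: (continuousB _ (@cst_continuous _ _ (equation H).2 _)).
exact: dot_continuous.
Qed.

(* The sides of a hyperplane do not depend on its equation, since two points lie
   strictly on one side iff the segment between them misses the hyperplane. *)
Lemma same_side_equation a b a' b' x y : hyperplane a b = hyperplane a' b' ->
  0 < (dot a x - b) * (dot a y - b) -> 0 < (dot a' x - b') * (dot a' y - b').
Proof.
move=> eqH same; set p := dot a' x - b'; set q := dot a' y - b'.
have miss z : dot a z - b != 0 -> dot a' z - b' != 0.
  rewrite !subr_eq0; apply: contra_neq => z0.
  suff : hyperplane a b z by [].
  by rewrite eqH.
rewrite ltNge; apply/negP => pq.
have p0 : p != 0 by apply: miss; apply: contraTneq same => ->; rewrite mul0r ltxx.
have pq0 : p - q != 0.
  apply: contraTneq pq => /eqP; rewrite subr_eq0 => /eqP <-.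
  by rewrite -expr2 -ltNge exprn_even_gt0.
have segE c d t : dot c (x + t *: (y - x)) - d =
    (1 - t) * (dot c x - d) + t * (dot c y - d).
  by rewrite -scaleN1r addrC !dotDZ; ring.
have pq2 : 0 < (p - q) ^+ 2 by rewrite exprn_even_gt0.
(* The affine form of [a'] vanishes at this parameter, which lies in [0, 1] since p and q do not
   have the same strict sign; the form of [a] has one strict sign at both ends, hence on the whole
   segment. *)
have /miss : dot a (x + (p / (p - q)) *: (y - x)) - b != 0.
  have t0 : 0 <= p / (p - q).
    have -> : p / (p - q) = (p * (p - q)) / (p - q) ^+ 2 by field.
    by apply: divr_ge0; [nra|exact: ltW].
  have t1 : 0 <= 1 - p / (p - q).
    have -> : 1 - p / (p - q) = (q * (q - p)) / (p - q) ^+ 2 by field.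
    by apply: divr_ge0; [nra|exact: ltW].
  rewrite segE; move: t0 t1 same; set t := p / (p - q).
  set f := dot a x - b; set g := dot a y - b => t0 t1 same.
  have f0 : f != 0 by apply: contraTneq same => ->; rewrite mul0r ltxx.
  have f2 : 0 < f ^+ 2 by rewrite exprn_even_gt0.
  apply/eqP => eq0.
  have : (1 - t) * f ^+ 2 + t * (f * g) = 0.
    by rewrite -[RHS](mulr0 f) -eq0; ring.
  apply/eqP; rewrite gt_eqF //.
  have [t_lt1|t_ge1] := ltP t 1.
    apply: ltr_wpDr; first exact: mulr_ge0 (ltW same).
    by rewrite mulr_gt0 // subr_gt0.
  apply: ltr_wpDl; first exact: mulr_ge0 (ltW f2).
  by rewrite mulr_gt0 // (lt_le_trans ltr01).
by rewrite segE -/p -/q; case/eqP; field.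
Qed.

Lemma same_sideP H x y : is_hyperplane H ->
  strictly_same_side H x y <-> 0 < height H x * height H y.
Proof.
move=> hH; have [a0 HE] := equationP hH; split=> [[a [b [_ HE' xb yb]]]|].
  apply: (@same_side_equation a b); first by rewrite -HE -HE'.
  by rewrite mulr_gt0 // subr_gt0.
have [hx|hx|->] := ltgtP (height H x) 0; last by rewrite mul0r ltxx.
  rewrite nmulr_rgt0 // => hy; exists (- (equation H).1), (- (equation H).2).
  rewrite oppr_eq0 a0 !dotNl !ltrN2 -![_ < (equation H).2]subr_lt0; split=> //.
  rewrite [LHS]HE; apply/seteqP; split=> z; rewrite /hyperplane /= dotNl.
    by move=> ->.
  exact: oppr_inj.
rewrite pmulr_rgt0 // => hy; exists (equation H).1, (equation H).2.
by rewrite -![_ < dot _ _]subr_gt0; split.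
Qed.

Lemma separates_height H U K x y : is_hyperplane H -> separates H U K ->
  U x -> K y -> height H x * height H y <= 0.
Proof.
move=> hH [a [b [_ HE' Ub Kb]]] Ux Ky; have [_ HE] := equationP hH.
rewrite leNgt; apply/negP => /(@same_side_equation _ _ a b).
rewrite -HE -HE' => /(_ erefl).
have /= := Ub _ Ux; have /= := Kb _ Ky.
nra.
Qed.

Lemma separates_meet H U K x : separates H U K -> U x -> K x -> H x.
Proof.
move=> [a [b [_ -> Ub Kb]]] Ux Kx.
by apply/eqP; rewrite eq_le; apply/andP; split; [exact: Ub|exact: Kb].
Qed.

(** The sign of [height H x] decides whether the chosen equation or its opposite is oriented as
    [separates] demands. *)
Lemma height_separates H U K x y : is_hyperplane H ->
  (forall z, U z -> 0 <= height H x * height H z) ->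
  (forall z, K z -> 0 <= height H y * height H z) ->
  height H x * height H y < 0 -> separates H U K.
Proof.
move=> hH Ux Ky; have [a0 HE] := equationP hH.
have [hx|hx|->] := ltgtP (height H x) 0; last by rewrite mul0r ltxx.
  rewrite nmulr_rlt0 // => hy; exists (equation H).1, (equation H).2.
  split=> // z /=; first by move/Ux; rewrite nmulr_rge0 // subr_le0.
  by move/Ky; rewrite pmulr_rge0 // subr_ge0.
rewrite pmulr_rlt0 // => hy; exists (- (equation H).1), (- (equation H).2).
rewrite oppr_eq0; split=> // [|z|z] /=.
- rewrite [LHS]HE; apply/seteqP; split=> z; rewrite /hyperplane /= dotNl.
    by move=> ->.
  exact: oppr_inj.
- by move/Ux; rewrite dotNl lerN2 pmulr_rge0 // subr_ge0.
- by move/Ky; rewrite dotNl lerN2 nmulr_rge0 // subr_le0.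
Qed.

End Height.

(** * Faces as sign conditions, and their affine spans *)

Section Cells.
Context {R : realType} {n : nat}.
Implicit Types (A : set (set 'rV[R]_n)) (x y z p q w : 'rV[R]_n) (e t : R).
Implicit Types (C F X H : set 'rV[R]_n).

Definition cell A x : set 'rV[R]_n := closure [set y | same_stratum A x y].

Lemma same_stratumP A x y : is_arrangement A ->
  same_stratum A x y <-> forall H, A H ->
    (height H x = 0 /\ height H y = 0) \/ 0 < height H x * height H y.
Proof.
move=> [hA _]; split=> xy H AH; have hH := hA H AH; case: (xy H AH).
- by move=> [/(height_eq0 _ hH) ? /(height_eq0 _ hH) ?]; left.
- by move=> /(same_sideP _ _ hH); right.
- by move=> [/(height_eq0 _ hH) ? /(height_eq0 _ hH) ?]; left.
- by move=> /(same_sideP _ _ hH); right.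
Qed.

(** The weak sign conditions are closed, which gives one inclusion. Conversely, a point satisfying
    them is a limit of points on the segment towards [x], which lie in the stratum of [x]. *)
Lemma cellE A x : is_arrangement A ->
  cell A x = [set y | forall H, A H ->
    (height H x = 0 -> height H y = 0) /\ 0 <= height H x * height H y].
Proof.
move=> hA; apply/seteqP; split=> [y|y xy].
  rewrite /cell closureE => /(_ [set y | forall H, A H ->
    (height H x = 0 -> height H y = 0) /\ 0 <= height H x * height H y]); apply.
  split=> [|z /(same_stratumP _ _ hA) xz H AH]; last first.
    have [[-> ->]|xz_gt0] := xz H AH; first by rewrite mul0r.
    split; last exact: ltW.
    by move=> hx; move: xz_gt0; rewrite hx mul0r ltxx.
  apply: (@closed_bigI _ _ A (fun H => [set y | height H x = 0 -> height H y = 0] `&`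
    (fun y => height H x * height H y) @^-1` [set r | 0 <= r])) => H AH.
  apply: closedI.
    have [->|hx] := eqVneq (height H x) 0.
      have -> : [set y | 0 = 0 :> R -> height H y = 0] = height H @^-1` [set r | r = 0].
        by apply/seteqP; split=> z //=; exact.
      apply: preimage_closed; last exact: closed_eq.
      by move=> z _; exact: height_continuous.
    suff -> : [set y | height H x = 0 -> height H y = 0] = setT by exact: closedT.
    by apply/seteqP; split=> z //= _ /eqP; rewrite (negbTE hx).
  apply: preimage_closed; last exact: closed_ge.
  move=> z _; apply: (continuousM (@cst_continuous _ _ (height H x) _)).
  exact: height_continuous.
move=> U /(nbhs_segment (x - y))[e e0 eU].
pose t := Num.min e 1.
have t0 : 0 < t by rewrite lt_min e0 ltr01.
have t1 : t <= 1 by rewrite ge_min lexx orbT.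
exists (y + t *: (x - y)); split; last by apply: eU; rewrite (ltW t0) ge_min lexx.
apply/(same_stratumP _ _ hA) => H AH; have [xy0 xy_ge0] := xy H AH.
rewrite height_segment.
have [hx|hx] := eqVneq (height H x) 0; first by left; rewrite xy0 // hx; split; ring.
right; have : 0 < height H x ^+ 2 by rewrite exprn_even_gt0.
nra.
Qed.

Lemma cell_refl A x : is_arrangement A -> cell A x x.
Proof.
by move=> hA; rewrite cellE // => H AH; split; last by rewrite -expr2 sqr_ge0.
Qed.

(* The segment issued from [z] avoids the hyperplanes that miss a suitable
   neighborhood of [z]; only finitely many others remain. *)
Lemma near_same_side A z w : is_arrangement A ->
  exists2 e, 0 < e & forall t, 0 <= t <= e -> forall H, A H ->
    height H z != 0 -> 0 < height H z * height H (z + t *: w).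
Proof.
move=> [hA /(_ z)[U zU finU]].
have [e e0 eU] := nbhs_segment w zU.
have one H : height H z != 0 ->
    exists2 d, 0 < d & forall t, 0 <= t <= d -> 0 < height H z * height H (z + t *: w).
  move=> hz; have zH : nbhs z [set y | 0 < height H z * height H y].
    have cH : {for z, continuous (fun y => height H z * height H y)}.
      apply: (continuousM (@cst_continuous _ _ (height H z) _)).
      exact: height_continuous.
    by apply: (cvgr_gt _ cH); rewrite -expr2 exprn_even_gt0.
  exact: nbhs_segment zH.
have [d d0 dP] : exists2 d, 0 < d & forall t, 0 <= t <= d -> forall H, A H ->
    H `&` U !=set0 -> height H z != 0 -> 0 < height H z * height H (z + t *: w).
  have [s sP] := (finite_seqP _).1 finU.
  suff [d d0 dP] : exists2 d, 0 < d & forall t, 0 <= t <= d -> forall H, H \in s ->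
      height H z != 0 -> 0 < height H z * height H (z + t *: w).
    exists d => // t td H AH HU; apply: dP => //.
    by have : [set` s] H by rewrite -sP.
  elim: s {sP} => [|H s [d d0 dP]]; first by exists 1.
  have [hz|/one[d' d'0 d'P]] := eqVneq (height H z) 0.
    exists d => // t td K; rewrite inE => /orP[/eqP ->|]; last exact: dP.
    by rewrite hz eqxx.
  exists (Num.min d d'); first by rewrite lt_min d0.
  move=> t /andP[t0]; rewrite le_min => /andP[td td'] K.
  rewrite inE => /orP[/eqP -> _|]; first by apply: d'P; rewrite t0.
  by apply: dP; rewrite t0.
exists (Num.min d e); first by rewrite lt_min d0.
move=> t /andP[t0]; rewrite le_min => /andP[td te] H AH hz.
have [HU|HU] := pselect (H `&` U !=set0); first by apply: dP => //; rewrite t0.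
have miss s : 0 <= s <= e -> height H (z + s *: w) != 0.
  move=> se; apply/eqP => /(height_eq0 _ (hA _ AH)) Hs; apply: HU.
  by exists (z + s *: w); split=> //; exact: eU.
rewrite ltNge; apply/negP; rewrite heightDZ.
set g := height H z; set k := dot _ _ => gk.
have g0 : 0 < g ^+ 2 by rewrite exprn_even_gt0.
have gk0 : g * k < 0 by nra.
have k0 : k != 0 by apply: contraTneq gk0 => ->; rewrite mulr0 ltxx.
(* The height vanishes at parameter -g / k, which [gk] places in [0, e], against [miss]; the
   rewritten quotient has a denominator of known sign. *)
have sE : - g / k = - g ^+ 2 / (g * k) by field; rewrite k0.
have : height H (z + (- g / k) *: w) != 0.
  apply: miss; rewrite sE ler_ndivlMr // mul0r ler_ndivrMr //; apply/andP; split; nra.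
by rewrite heightDZ -/g -/k; case/eqP; field.
Qed.

(** A point y on all hyperplanes through z is the combination, with weights 1 - 1/e and 1/e, of z
    and z + e (y - z), both in the cell for small e. *)
Lemma affine_span_cell A z : is_arrangement A ->
  affine_span (cell A z) = \bigcap_(H in [set H | A H /\ H z]) H.
Proof.
move=> hA; have [hyp _] := hA.
apply/seteqP; split=> [_ [m [l [p [zp l1 ->]]]] H [AH Hz]|y yP].
  have hH := hyp H AH; apply/(height_eq0 _ hH).
  have p0 i : height H (p i) = 0.
    have := zp i; rewrite cellE // => /(_ H AH)[+ _]; apply.
    exact/(height_eq0 _ hH).
  rewrite /height dot_lincomb -[_.2]mul1r -l1 mulr_suml -sumrB big1 // => i _.
  by rewrite -mulrBr -/(height H (p i)) p0 mulr0.
have [e e0 eP] := near_same_side z (y - z) hA.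
exists 2, (fun i => if i == 0 then 1 - e^-1 else e^-1),
  (fun i => if i == 0 then z else z + e *: (y - z)); split.
- move=> i; case: ifP => _; first exact: cell_refl.
  rewrite cellE // => H AH; have hH := hyp H AH.
  have [hz|hz] := eqVneq (height H z) 0.
    have Hy : height H y = 0.
      by apply/(height_eq0 _ hH); apply: yP; split=> //; exact/(height_eq0 _ hH).
    by rewrite height_segment hz Hy; split=> *; rewrite ?mul0r ?mulr0 ?addr0.
  split=> [hz0|]; first by rewrite hz0 eqxx in hz.
  by apply/ltW/eP => //; rewrite (ltW e0) lexx.
- by rewrite !big_ord_recl big_ord0 /=; ring.
- rewrite !big_ord_recl big_ord0 /= addr0 scalerDr scalerA mulVf ?gt_eqF // scale1r.
  by rewrite addrA -scalerDl subrK scale1r addrC subrK.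
Qed.

End Cells.

(** * Chambers, projections onto them, and the two inclusions for J(C) *)

Section Chambers.
Context {R : realType} {n : nat}.
Implicit Types (A : set (set 'rV[R]_n)) (x y z p q : 'rV[R]_n) (e t : R).
Implicit Types (C F X Y H : set 'rV[R]_n).

Lemma hyperplane_neq_setT H : is_hyperplane H -> H <> setT.
Proof.
move=> [a [b [a0 ->]]] HT.
have onH x : dot a x = b by have : hyperplane a b x by rewrite HT.
case/eqP: a0; apply: dot_eq0; rewrite onH -(onH 0).
by rewrite /dot big1 // => i _; rewrite mxE mulr0.
Qed.

(** A nonzero height at [z] links the signs at [q] and [y]: multiply the two conditions and divide
    by its square. A zero height at [z] is also zero at [y]. *)
Lemma cell_subset A z q : is_arrangement A -> cell A q z -> cell A z `<=` cell A q.
Proof.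
move=> hA; rewrite !cellE // => qz y zy H AH.
have [qz0 qz_ge0] := qz H AH; have [zy0 zy_ge0] := zy H AH.
split=> [/qz0/zy0 //|].
have [/zy0 ->|hz] := eqVneq (height H z) 0; first by rewrite mulr0.
have z2 : 0 < height H z ^+ 2 by rewrite exprn_even_gt0.
rewrite -(pmulr_lge0 _ z2).
have -> : height H q * height H y * height H z ^+ 2 =
  (height H q * height H z) * (height H z * height H y) by ring.
exact: mulr_ge0.
Qed.

(** No hyperplane passes through [p], so the affine span of its cell is an empty intersection, the
    whole space. *)
Lemma chamber_cell A p : is_arrangement A -> (forall H, A H -> height H p != 0) ->
  chamber A (cell A p).
Proof.
move=> hA p0; split; first by exists p.
exists 0, fullv; split; last by rewrite addn0 dimvf /dim /= mul1n.
rewrite affine_span_cell //; apply/seteqP; split=> y //= _; first by rewrite memvf.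
by move=> H [AH /(height_eq0 _ (hA.1 H AH))/eqP]; rewrite (negbTE (p0 H AH)).
Qed.

(** A hyperplane through [p] would contain the affine span of [C], which is the whole space in
    codimension 0. *)
Lemma chamberP A C : is_arrangement A -> chamber A C ->
  exists2 p, C = cell A p & forall H, A H -> height H p != 0.
Proof.
move=> hA [[p CE]]; rewrite -/(cell A p) in CE => -[q [V [spanC dimV]]].
exists p => // H AH; apply/eqP => /(height_eq0 _ (hA.1 H AH)) Hp.
apply: (hyperplane_neq_setT (hA.1 H AH)); apply/seteqP; split=> // y _.
have VT : V = fullv.
  by apply/eqP; rewrite eqEdim subvf dimvf /dim /= mul1n -[X in (X <= _)%N]dimV addn0.
have : affine_span C y by rewrite spanC /= VT memvf.
by rewrite CE affine_span_cell //; apply.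
Qed.

Lemma smallest_face_cell A C z : is_arrangement A -> face A C -> C z ->
  is_smallest_face A C z (cell A z).
Proof.
move=> hA [p ->] pz; split; last by move=> G [[q ->] _] qz; exact: cell_subset.
  by split; [exists z|exact: cell_subset].
exact: cell_refl.
Qed.

Lemma cell_eq A p q : is_arrangement A ->
  (forall H, A H -> 0 < height H p * height H q) -> cell A p = cell A q.
Proof.
move=> hA pq; apply/seteqP; split; apply: cell_subset => //; rewrite cellE // => H AH.
- split; last by rewrite mulrC ltW ?pq.
  by move=> q0; move: (pq H AH); rewrite q0 mulr0 ltxx.
- split; last by rewrite ltW ?pq.
  by move=> p0; move: (pq H AH); rewrite p0 mul0r ltxx.
Qed.

Lemma flat_bigcap A (B : set (set 'rV[R]_n)) z : B `<=` A ->
  (forall H, B H -> H z) -> flat A (\bigcap_(H in B) H).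
Proof. by move=> BA Bz; split; [exists z => H BH; exact: Bz|exists B]. Qed.

Lemma chamber_rho A C x : is_arrangement A -> chamber A C ->
  C (rho C x) /\ eucl_dist x (rho C x) = dist_to x C.
Proof.
move=> hA [[p ->] _]; apply: rho_nearest; first exact: closed_closure.
by exists p; exact: cell_refl.
Qed.

(* Near the projection of [x] onto the chamber of [p], the chamber agrees with the
   cone cut out by the hyperplanes through that projection, so by convexity the
   projection is the point of the whole cone nearest to [x]. *)
Lemma rho_nearest_in_cone A p x y : is_arrangement A ->
  (forall H, A H -> height H p != 0) -> let z := rho (cell A p) x in
  (forall H, A H -> height H z = 0 -> 0 <= height H p * height H y) ->
  eucl_dist x z <= eucl_dist x y /\ (eucl_dist x y <= eucl_dist x z -> z = y).
Proof.
move=> hA p0 z cone_y; have [Cz distz] := chamber_rho x hA (chamber_cell hA p0).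
rewrite -/z in Cz distz.
have [e e0 eP] := near_same_side z (y - z) hA.
apply: (nearest_on_ray e0) => t te; rewrite distz; apply: dist_to_le.
rewrite cellE // => H AH; split=> [/eqP|]; first by rewrite (negbTE (p0 H AH)).
have [hz|hz] := eqVneq (height H z) 0.
  rewrite height_segment hz mulr0 add0r mulrCA.
  by case/andP: te => t0 _; rewrite mulr_ge0 // cone_y.
have z2 : 0 < height H z ^+ 2 by rewrite exprn_even_gt0.
have := eP t te H AH hz; move: Cz; rewrite cellE // => /(_ H AH)[_].
rewrite -/z; set f := height H z; set g := height H (z + _) => pz zg.
rewrite -(pmulr_lge0 _ z2).
have -> : height H p * g * f ^+ 2 = (height H p * f) * (f * g) by ring.
by rewrite mulr_ge0 // ltW.
Qed.

(** Used for C' preceding C: [H] then belongs to the support of X_C, so X_C and every flat contained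
    in it lie in J(C). *)
Lemma separated_at_rho A C C' x : is_arrangement A -> chamber A C -> chamber A C' ->
  C' <> C -> dist_to x C' <= dist_to x C ->
  exists H, [/\ A H, H (rho C x) & separates H C C'].
Proof.
move=> hA hC hC' neqC le_dist; apply: contrapT => nosep.
have [p CE p0] := chamberP hA hC; have [p' CE' p'0] := chamberP hA hC'.
have [Cz distz] := chamber_rho x hA hC; have [Cz' distz'] := chamber_rho x hA hC'.
have side H y : A H -> C y -> 0 <= height H p * height H y.
  by move=> AH; rewrite CE cellE // => /(_ H AH)[].
have side' H y : A H -> C' y -> 0 <= height H p' * height H y.
  by move=> AH; rewrite CE' cellE // => /(_ H AH)[].
have sepH H : A H -> ~ separates H C C' -> 0 < height H p * height H p'.
  move=> AH nsep; rewrite lt_neqAle eq_sym mulf_neq0 ?p0 ?p'0 //= leNgt.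
  apply/negP => pp'; apply: nsep; apply: (height_separates (hA.1 H AH) _ _ pp') => z.
    exact: side.
  exact: side'.
(* By [nosep], the hyperplanes through the projection onto [C] have [C] and [C'] on the same side.
   The projection onto [C'] thus lies in the cone, and it is no farther from [x]. *)
have same_proj : rho C x = rho C' x.
  have [|_] := @rho_nearest_in_cone A p x (rho C' x) hA p0; last first.
    by rewrite -CE; apply; rewrite distz distz'.
  rewrite -CE => H AH /(height_eq0 _ (hA.1 H AH)) Hz.
  have pp' : 0 < height H p * height H p'.
    by apply: sepH => // sepC; apply: nosep; exists H.
  have p'2 : 0 < height H p' ^+ 2 by rewrite exprn_even_gt0 ?p'0.
  rewrite -(pmulr_lge0 _ p'2).
  have -> : height H p * height H (rho C' x) * height H p' ^+ 2 =
    (height H p * height H p') * (height H p' * height H (rho C' x)) by ring.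
  by apply: mulr_ge0; [exact: ltW|exact: side'].
apply: neqC; rewrite CE CE'; apply/esym/cell_eq => // H AH; apply: sepH => // sepC.
apply: nosep; exists H; split=> //; apply: (separates_meet sepC Cz).
by rewrite same_proj.
Qed.

(** The separation hypothesis holds for Y in J(C), since in a Euclidean order every chamber strictly
    closer to the base point than C precedes C. *)
Lemma flat_sub_of_separated A C Y x : is_arrangement A -> chamber A C -> flat A Y ->
  (forall L L', flat A L -> flat A L' -> L' `<` L -> dist_to x L < dist_to x L') ->
  (forall C', chamber A C' -> dist_to x C' < dist_to x C ->
     supp A Y `&` sep A C C' !=set0) ->
  Y `<=` affine_span (cell A (rho C x)).
Proof.
move=> hA hC flatY gen sepY.
have [p CE p0] := chamberP hA hC; have [Cz distz] := chamber_rho x hA hC.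
set z := rho C x in Cz distz *.
have cell_z H : A H -> 0 <= height H p * height H z.
  by move=> AH; move: Cz; rewrite CE cellE // => /(_ H AH)[].
have nearest y : (forall H, A H -> Y `<=` H -> 0 <= height H p * height H y) ->
    eucl_dist x z <= eucl_dist x y.
  move=> cone_y; rewrite leNgt; apply/negP => lt_yz.
  (* Pushing [y] slightly towards [p] gives a point [q] off every hyperplane, whose chamber contains
     [y] and so is closer to [x] than [C]. A hyperplane containing [Y] must separate the two, but
     [cone_y] puts [q] strictly on the side of [p]. *)
  have [e e0 eP] := near_same_side y (p - y) hA.
  pose t := Num.min e 1; pose q := y + t *: (p - y).
  have t0 : 0 < t by rewrite lt_min e0 ltr01.
  have t1 : t <= 1 by rewrite ge_min lexx orbT.
  have yq H : A H -> height H y != 0 -> 0 < height H y * height H q.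
    by move=> AH; apply: eP => //; rewrite (ltW t0) ge_min lexx.
  have q0 H : A H -> height H q != 0.
    move=> AH; have [hy|hy] := eqVneq (height H y) 0.
      by rewrite height_segment hy mulr0 add0r mulf_neq0 ?p0 // gt_eqF.
    by apply: contraTneq (yq H AH hy) => ->; rewrite mulr0 ltxx.
  have qy : cell A q y.
    rewrite cellE // => H AH; split=> [/eqP|]; first by rewrite (negbTE (q0 H AH)).
    have [->|hy] := eqVneq (height H y) 0; first by rewrite mulr0.
    by rewrite mulrC ltW ?yq.
  have [|H [[AH YH] [_ sepH]]] := sepY _ (chamber_cell hA q0).
    by rewrite -distz; apply: le_lt_trans lt_yz; exact: dist_to_le.
  have : height H p * height H q <= 0.
    apply: (separates_height (hA.1 H AH) sepH); last exact: cell_refl.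
    by rewrite CE; exact: cell_refl.
  rewrite height_segment; have := cone_y H AH YH.
  have : 0 < height H p ^+ 2 by rewrite exprn_even_gt0 ?p0.
  nra.
pose B := [set H | [/\ A H, Y `<=` H & H z]]; pose Z := \bigcap_(H in B) H.
(* Near [z], the segment to [y] satisfies the conditions of [nearest]: for hyperplanes containing
   [Y], heights zero at [z] vanish along it and the others keep their sign. *)
have nearestZ y : Z y -> eucl_dist x z <= eucl_dist x y.
  move=> Zy; have [e e0 eP] := near_same_side z (y - z) hA.
  apply: (proj1 (nearest_on_ray e0 _)) => t te.
  apply: nearest => H AH YH; have hH := hA.1 H AH.
  have [hz|hz] := eqVneq (height H z) 0.
    have hy : height H y = 0.
      by apply/(height_eq0 _ hH); apply: Zy; split=> //; exact/(height_eq0 _ hH).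
    by rewrite height_segment hz hy !mulr0 addr0 mulr0.
  have z2 : 0 < height H z ^+ 2 by rewrite exprn_even_gt0.
  rewrite -(pmulr_lge0 _ z2).
  have -> : height H p * height H (z + t *: (y - z)) * height H z ^+ 2 =
    (height H p * height H z) * (height H z * height H (z + t *: (y - z))) by ring.
  by rewrite mulr_ge0 ?cell_z // ltW ?eP.
have Zz : Z z by move=> H [].
have flatZ : flat A Z by apply: (@flat_bigcap A B z) => H [].
rewrite affine_span_cell //; set X := \bigcap_(H in _) H.
have flatX : flat A X by apply: (@flat_bigcap A _ z) => H [].
have YZ : Y `<=` Z by move=> y Yy H [_ YH _]; exact: YH.
suff ZX : Z `<=` X by exact: subset_trans ZX.
apply: contrapT => nZX.
(* Genericity would make [X] strictly farther from [x] than [Z], yet [X] contains [z], a nearest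
   point of [Z]. *)
have /(gen _ _ flatZ flatX) : X `<` Z.
  by split=> // y Xy H [AH _ Hz]; apply: Xy.
apply/negP; rewrite -leNgt.
apply: le_trans (dist_to_ge (b := eucl_dist x z) _ nearestZ).
  by apply: dist_to_le => H [].
by exists z.
Qed.

End Chambers.

Theorem theorem5p7 (R : realType) (n : nat) (A : set (set 'rV[R]_n))
    (ord : set 'rV[R]_n -> set 'rV[R]_n -> Prop) (x0 : 'rV[R]_n)
    (hA : is_arrangement A) (hord : euclidean_order A ord x0) :
  (forall C : set 'rV[R]_n, chamber A C ->
     exists2 F_C : set 'rV[R]_n,
       is_smallest_face A C (rho C x0) F_C &
       principal_upper_ideal A (J A ord C) (affine_span F_C)) /\
  valid_order A ord.
Proof.
have [[irr trans tot] [_ gen] ord_dist] := hord.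
have main C : chamber A C -> exists2 F,
    is_smallest_face A C (rho C x0) F &
    principal_upper_ideal A (J A ord C) (affine_span F).
  move=> hC; have [Cz _] := chamber_rho x0 hA hC.
  exists (cell A (rho C x0)); first exact: smallest_face_cell hA hC.1 Cz.
  have spanE := affine_span_cell (rho C x0) hA.
  split; first by rewrite spanE; apply: (@flat_bigcap _ _ A _ (rho C x0)) => H [].
  apply/seteqP; split=> Y [flatY HY]; split=> //.
    apply: (flat_sub_of_separated hA hC flatY gen) => C' hC' ltC.
    apply: HY => //; have [//|eqC|/(ord_dist _ _ hC hC')] := tot _ _ hC' hC.
      by rewrite eqC ltxx in ltC.
    by rewrite leNgt ltC.
  move=> C' hC' ordC.
  have [|H [AH Hz sepH]] := separated_at_rho hA hC hC' _ (ord_dist _ _ hC' hC ordC).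
    by move=> eqC; rewrite eqC in ordC; exact: irr ordC.
  exists H; split; split=> // y /HY; rewrite spanE; apply; split=> //.
split=> //; split; first by split.
by move=> C /main[F [Fface _ _] FJ]; exists F.
Qed.
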